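(* Let $M,n\ge 1$, let $q\in\mathbb{R}^M_{>0}$, and for $k=1,\dots,n$ let $A^k\in\mathbb{R}^{m_k\times M}$, $b^k\in\mathbb{R}^{m_k}$ and $\mathcal{C}^k=\{x\in\Delta_M: A^kx=b^k\}$. Let $\mathcal{C}=\bigcap_{k=1}^n\mathcal{C}^k$ and assume $\mathcal{C}\neq\emptyset$. Let $I_{\mathrm{GIS}}\subset\{1,\dots,n\}$ be an arbitrary subset. For $k\in I_{\mathrm{GIS}}$ let $(\hat A^k,\hat b^k)$ denote the normalized version of $(A^k,b^k)$ (described in the context). Extend all indices $n$-periodically, i.e. $\mathcal{C}^{k+nl}=\mathcal{C}^k$, $\hat A^{k+nl}=\hat A^k$, $\hat b^{k+nl}=\hat b^k$ for $k\in\{1,\dots,n\}$, $l\in\mathbb{N}$. Define $p^{(0)}=q$ and, for $k=1,2,\dots$, $$p^{(k)}=\begin{cases} p^{(k-1)}\odot\exp\Big((\hat A^k)^{\mathrm T}\log\dfrac{\hat b^k}{\hat A^kp^{(k-1)}}\Big), & k\in I_{\mathrm{GIS}}+n\mathbb{N}_0,\\[2mm] P^{\mathrm{KL}}_{\mathcal{C}^k}(p^{(k-1)}), & k\notin I_{\mathrm{GIS}}+n\mathbb{N}_0.\end{cases}$$ Then $$\lim_{k\to\infty}p^{(k)}=P^{\mathrm{KL}}_{\mathcal{C}}(q)=\operatorname*{argmin}_{p\in\mathcal{C}}\mathrm{KL}(p,q).$$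
   Context: Notation. $\Delta_M=\{x\in\mathbb{R}^M: x\ge 0,\ \sum_j x_j=1\}$ is the closed probability simplex. $\mathbb{N}_0=\{0,1,2,\dots\}$. $\odot$ is element-wise multiplication; division of vectors, $\exp$ and $\log$ are element-wise. $\mathbf 1_m$ is the all-ones vector in $\mathbb{R}^m$. Kullback--Leibler divergence: for $p,q\in\mathbb{R}^M$, $\mathrm{KL}(p,q)=\sum_{i=1}^M\big(p_i\log\frac{p_i}{q_i}-p_i+q_i\big)$ if $p,q\ge0$ and $q_i=0$ implies $p_i=0$ for all $i$, and $\mathrm{KL}(p,q)=\infty$ otherwise, with the convention $0\log 0=0\log\frac00=0$. The vectors need not be normalized. Information projection: for a set $\mathcal{D}\subset\Delta_M$ and $p\in\mathbb{R}^M_{\ge0}$, $P^{\mathrm{KL}}_{\mathcal{D}}(p)=\operatorname*{argmin}_{r\in\mathcal{D}}\mathrm{KL}(r,p)$ (the unique minimizer). Normalization of a system $(A,b)$, $A\in\mathbb{R}^{m\times M}$, $b\in\mathbb{R}^m$: 1. Set $\xi=\min\{\min_{ij}A_{ij},\min_ib_i\}$, $A^{(1)}=A-\xi$, $b^{(1)}=b-\xi$ (the constant is subtracted from every entry). 2. Set $\xi'=\max\{\max_j(\mathbf 1_m^{\mathrm T}A^{(1)})_j,\ \mathbf 1_m^{\mathrm T}b^{(1)}\}$, $A^{(2)}=\frac1{\xi'}A^{(1)}$, $b^{(2)}=\frac1{\xi'}b^{(1)}$ (if $\xi'=0$, i.e. $A^{(1)}=0$ and $b^{(1)}=0$, no rescaling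 is made). 3. Remove any row $i$ with $A^{(2)}_{ij}=0$ for all $j$ and $b^{(2)}_i=0$; then append one further row, consisting of $1$ minus the column sums of $A^{(2)}$, to $A^{(2)}$, and the entry $1$ minus the sum of the entries of $b^{(2)}$ to $b^{(2)}$. The result is $(\hat A,\hat b)$. The normalized system satisfies $\hat A,\hat b\ge0$, all column sums of $\hat A$ equal $1$, the entries of $\hat b$ sum to $1$, and $\{x\in\Delta_M:\hat Ax=\hat b\}=\{x\in\Delta_M:Ax=b\}$. Convention for zero entries in the multiplicative step: the $j$-th component of $\exp\big(\hat A^{\mathrm T}\log\frac{\hat b}{\hat Ap}\big)$ is read as $\prod_i\big(\hat b_i/(\hat Ap)_i\big)^{\hat A_{ij}}$, with $0^0=1$ and $\frac00:=1$. *)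

(* Defs.v *)
From mathcomp Require Import all_boot all_order all_algebra.
From mathcomp Require Import all_classical all_reals all_analysis.

Set Implicit Arguments.
Unset Strict Implicit.
Unset Printing Implicit Defensive.

Import Order.TTheory GRing.Theory Num.Theory.
Import numFieldNormedType.Exports.

Local Open Scope classical_set_scope.
Local Open Scope ring_scope.

Definition simplex (R : realType) (M : nat) : set 'cV[R]_M :=
  [set x | (forall j, 0 <= x j 0) /\ \sum_j x j 0 = 1].

Definition constraint_set (R : realType) (m M : nat)
    (A : 'M[R]_(m, M)) (b : 'cV[R]_m) : set 'cV[R]_M :=
  [set x | simplex x /\ A *m x = b].

(* When p i 0 = 0 the logarithmic term vanishes whatever the value of [ln],
   which is the convention 0 log 0 = 0 log (0/0) = 0. *)
Definition KL (R : realType) (M : nat) (p q : 'cV[R]_M) : \bar R :=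
  if [forall i, [&& 0 <= p i 0, 0 <= q i 0 & (q i 0 == 0) ==> (p i 0 == 0)]]
  then (\sum_i (p i 0 * ln (p i 0 / q i 0) - p i 0 + q i 0))%:E
  else +oo%E.

Definition KLargmin (R : realType) (M : nat) (D : set 'cV[R]_M)
    (p : 'cV[R]_M) : set 'cV[R]_M :=
  [set r | D r /\ forall s, D s -> (KL r p <= KL s p)%E].

(* The value is meaningful only when [KLargmin D p] is a singleton. *)
Definition KLproj (R : realType) (M : nat) (D : set 'cV[R]_M)
    (p : 'cV[R]_M) : 'cV[R]_M := xget 0 (KLargmin D p).

Section Normalization.
Variables (R : realType) (m M : nat) (A : 'M[R]_(m, M)) (b : 'cV[R]_m).

(* Seeding the minimum with the first entry makes it the true minimum whenever
   there is an entry; for m = 0 there is none and the value is irrelevant. *)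
Definition norm_shift : R :=
  let s := [seq A i j | i <- enum 'I_m, j <- enum 'I_M]
             ++ [seq b i 0 | i <- enum 'I_m] in
  \big[Num.min/(head 0 s)]_(x <- s) x.

Definition norm_A1 : 'M[R]_(m, M) := \matrix_(i, j) (A i j - norm_shift).
Definition norm_b1 : 'cV[R]_m := \col_i (b i 0 - norm_shift).

Definition norm_scale : R :=
  \big[Num.max/(\sum_i norm_b1 i 0)]_(j < M) \sum_i norm_A1 i j.

Definition norm_A2 : 'M[R]_(m, M) :=
  if norm_scale == 0 then norm_A1 else norm_scale^-1 *: norm_A1.
Definition norm_b2 : 'cV[R]_m :=
  if norm_scale == 0 then norm_b1 else norm_scale^-1 *: norm_b1.

Definition norm_rows : {set 'I_m} :=
  [set i | ~~ ([forall j, norm_A2 i j == 0] && (norm_b2 i 0 == 0))]%SET.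

Definition norm_A : 'M[R]_(#|norm_rows| + 1, M) :=
  col_mx (\matrix_(i < #|norm_rows|, j < M) norm_A2 (enum_val i) j)
         (\row_j (1 - \sum_i norm_A2 i j)).
Definition norm_b : 'cV[R]_(#|norm_rows| + 1) :=
  col_mx (\col_(i < #|norm_rows|) norm_b2 (enum_val i) 0)
         (\col_(i < 1) (1 - \sum_l norm_b2 l 0)).

End Normalization.

(* Quotient with 0 / 0 = 1. *)
Definition ratio (R : realType) (x y : R) : R :=
  if (x == 0) && (y == 0) then 1 else x / y.

(* The product is exp (A^T log (b / (A p))), with 0 `^ 0 = 1. *)
Definition mult_step (R : realType) (m M : nat) (A : 'M[R]_(m, M))
    (b : 'cV[R]_m) (p : 'cV[R]_M) : 'cV[R]_M :=
  \col_j (p j 0 * \prod_i (ratio (b i 0) ((A *m p) i 0) `^ A i j)).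

Definition cyc (n : nat) (hn : (0 < n)%N) (k : nat) : 'I_n :=
  Ordinal (ltn_pmod k hn).

(* Systems are numbered from 0: the passage from the k-th to the (k+1)-st
   iterate uses the system [k mod n]. *)
Fixpoint iterate (R : realType) (M n : nat) (hn : (0 < n)%N) (m : 'I_n -> nat)
    (A : forall k, 'M[R]_(m k, M)) (b : forall k, 'cV[R]_(m k))
    (I_GIS : {set 'I_n}) (q : 'cV[R]_M) (k : nat) : 'cV[R]_M :=
  if k is k'.+1 then
    let i := cyc hn k' in
    let p := iterate hn A b I_GIS q k' in
    if i \in I_GIS then mult_step (norm_A (A i) (b i)) (norm_b (A i) (b i)) p
    else KLproj (constraint_set (A i) (b i)) p
  else q.

(* Main.v *)
(* Write p_k for the iterates and C for the intersection of the constraint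
   sets C_i.  A projection step satisfies the Pythagorean identity
   KL(x, p_k) = KL(x, p_(k+1)) + KL(p_(k+1), p_k) for x in C_i, and a
   multiplicative step satisfies
   KL(x, p_k) = KL(x, p_(k+1)) + KL(b, A p_k) + (1 - sum p_(k+1)),
   where the last summand is nonnegative by the weighted AM-GM inequality.  So
   every step decreases KL(x, p_k) by an amount d_k >= 0 that does not depend on
   x in C, and the series of the d_k is bounded by KL(x, q).  Since d_k -> 0,
   a cluster point l of the subsequence p_(n t) is also a cluster point, along
   the same ultrafilter, of each p_(n t + r), and l belongs to every C_i.  Then
   KL(l, p_k) is monotone with a subsequence tending to 0, so p_k -> l, and the
   sum of the d_k is KL(l, q); as it is at most KL(x, q) for each x in C, l is
   the minimizer. *)

Require Import Defs.
From mathcomp Require Import all_boot all_order all_algebra.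
From mathcomp Require Import all_classical all_reals all_analysis.
From mathcomp Require Import ring lra.

Set Implicit Arguments.
Unset Strict Implicit.
Unset Printing Implicit Defensive.

Import Order.TTheory GRing.Theory Num.Theory.
Import numFieldNormedType.Exports.

Local Open Scope classical_set_scope.
Local Open Scope ring_scope.

(** * Scalar divergence terms *)

(** At [y = 0 < x] the value is [- x] rather than infinity; this is why the lemmas below carry the
    hypothesis [0 < x -> 0 < y]. *)
Definition kl (R : realType) (x y : R) : R := x * ln (x / y) - x + y.

Lemma kl0 (R : realType) (y : R) : kl 0 y = y.
Proof. by rewrite /kl mul0r subr0 add0r. Qed.

Lemma klxx (R : realType) (x : R) : kl x x = 0.
Proof.
rewrite /kl; have [->|x0] := eqVneq x 0; first by rewrite mul0r subr0 addr0.
by rewrite divff // ln1 mulr0 sub0r addNr.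
Qed.

Lemma ln_le_sub1 (R : realType) (u : R) : 0 < u -> ln u <= u - 1.
Proof.
by move=> u0; have := @le_ln1Dx R (u - 1); rewrite subrKC; apply; lra.
Qed.

(** Change of reference point: the correction is affine in [x]. This drives the Pythagorean identity
    and the semicontinuity argument. *)
Lemma kl_subr (R : realType) (x r y : R) :
  0 <= x -> (0 < x -> 0 < r) -> (0 < x -> 0 < y) ->
  kl x y = kl x r + x * ln (r / y) + y - r.
Proof.
rewrite le_eqVlt => /predU1P[<-|x0] xr xy.
  by rewrite !kl0; ring.
have [r0 y0] := (xr x0, xy x0).
rewrite /kl !ln_div ?posrE //; ring.
Qed.

(** With [u], [v] the square roots, insert ln (v / u) <= v / u - 1 into 2 u^2 (ln u - ln v) - u^2 +
    v^2. *)
Lemma hellinger_le_kl (R : realType) (x y : R) :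
  0 <= x -> 0 <= y -> (0 < x -> 0 < y) ->
  (Num.sqrt x - Num.sqrt y) ^+ 2 <= kl x y.
Proof.
rewrite le_eqVlt => /predU1P[<-|x0] y0 xy.
  by rewrite kl0 sqrtr0 sub0r sqrrN sqr_sqrtr.
have {y0 xy} y0 := xy x0.
rewrite -{2}(sqr_sqrtr (ltW x0)) -{2}(sqr_sqrtr (ltW y0)).
set u := Num.sqrt x; set v := Num.sqrt y.
have [u0 v0] : 0 < u /\ 0 < v by rewrite !sqrtr_gt0.
have := @ln_le_sub1 R (v / u) (divr_gt0 v0 u0).
rewrite /kl -expr_div_n lnXn ?divr_gt0 // !ln_div ?posrE // => h.
have : u ^+ 2 * (ln v - ln u) <= u ^+ 2 * (v / u - 1).
  by rewrite ler_pM2l // exprn_gt0.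
rewrite (_ : u ^+ 2 * (v / u - 1) = u * v - u ^+ 2); last first.
  by field; rewrite gt_eqF.
by rewrite -mulr_natl; lra.
Qed.

(** A Pinsker-type bound: factor x - y = (u - v)(u + v) and use (u + v)^2 <= 2 (u^2 + v^2). For
    bounded arguments it turns a small divergence into a small distance. *)
Lemma sqr_sub_le_kl (R : realType) (x y : R) :
  0 <= x -> 0 <= y -> (0 < x -> 0 < y) ->
  (x - y) ^+ 2 <= 2 * (x + y) * kl x y.
Proof.
move=> x0 y0 xy; have := hellinger_le_kl x0 y0 xy.
move: (sqr_sqrtr x0) (sqr_sqrtr y0).
move: (Num.sqrt x) (Num.sqrt y) => u v ux vy klge.
apply: (@le_trans _ _ (2 * (x + y) * (u - v) ^+ 2)); last first.
  by rewrite ler_wpM2l // mulr_ge0 // addr_ge0.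
rewrite -ux -vy subr_sqr exprMn mulrC ler_wpM2r ?sqr_ge0 //.
have := sqr_ge0 (u - v); nra.
Qed.

Lemma kl_ge0 (R : realType) (x y : R) :
  0 <= x -> 0 <= y -> (0 < x -> 0 < y) -> 0 <= kl x y.
Proof.
move=> x0 y0 xy; have := sqr_sub_le_kl x0 y0 xy.
move: x0; rewrite le_eqVlt => /predU1P[<-|x0]; first by rewrite kl0.
move=> h; have {h} := le_trans (sqr_ge0 _) h.
by rewrite pmulr_rge0 // mulr_gt0 // ltr_pwDl.
Qed.

Lemma kl_eq0 (R : realType) (x y : R) :
  0 <= x -> 0 <= y -> (0 < x -> 0 < y) -> kl x y = 0 -> x = y.
Proof.
move=> x0 y0 xy e; have := sqr_sub_le_kl x0 y0 xy.
by rewrite e mulr0 real_exprn_even_le0 ?num_real //= subr_eq0 => /eqP.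
Qed.

(** Passing through the reference point [z] on both left-hand terms leaves affine corrections, whose
    weighted average is the correction at [z]. *)
Lemma kl_convex_combination (R : realType) (r x y t : R) :
  0 <= r -> 0 <= x -> (0 < r -> 0 < y) -> (0 < x -> 0 < y) -> 0 < t < 1 ->
  let z := r + t * (x - r) in
  (1 - t) * kl r y + t * kl x y
    = kl z y + (1 - t) * kl r z + t * kl x z.
Proof.
move=> r0 x0 ry xy /andP[t0 t1] z.
have zE : z = (1 - t) * r + t * x by rewrite /z; ring.
have z0 : 0 <= z by rewrite zE addr_ge0 // mulr_ge0 //; lra.
have rz : 0 < r -> 0 < z.
  by move=> rp; rewrite zE ltr_pwDl // ?mulr_gt0 ?mulr_ge0 //; lra.
have xz : 0 < x -> 0 < z.
  by move=> xp; rewrite zE ltr_wpDl // ?mulr_gt0 ?mulr_ge0 //; lra.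
have zy : 0 < z -> 0 < y.
  move: r0; rewrite le_eqVlt => /predU1P[r0|/ry //].
  move: x0; rewrite le_eqVlt => /predU1P[x0|/xy //].
  by have -> : z = 0 by [rewrite zE -x0 -r0; ring]; rewrite ltxx.
rewrite (kl_subr r0 rz ry) (kl_subr x0 xz xy) (kl_subr z0 id zy) klxx.
rewrite {7}zE; ring.
Qed.

(** Follows from ln (z / r) <= z / r - 1 = t (x - r) / r with z the moved point. The loss is linear
    in [t], so it disappears as [t] tends to 0. *)
Lemma kl_near_ge (R : realType) (x r t : R) :
  0 <= x -> 0 <= r -> (0 < x -> 0 < r) -> 0 < t < 1 ->
  kl x r - t * ((x - r) ^+ 2 / r) <= kl x (r + t * (x - r)).
Proof.
move=> x0 + xr /andP[t0 t1]; rewrite le_eqVlt => /predU1P[r0|r0].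
  have {}x0 : x = 0.
    by apply: le_anti; rewrite x0 andbT leNgt; apply/negP => /xr; rewrite -r0 ltxx.
  by rewrite x0 -r0 invr0 subr0 !mulr0 subr0 addr0.
have z0 : 0 < r + t * (x - r).
  rewrite (_ : _ + _ = (1 - t) * r + t * x); last by ring.
  by rewrite ltr_pwDl // ?mulr_gt0 ?mulr_ge0 //; lra.
rewrite (@kl_subr R x r (r + t * (x - r))) //.
have : ln ((r + t * (x - r)) / r) <= t * (x - r) / r.
  apply: le_trans (ln_le_sub1 _) _; first exact: divr_gt0.
  by rewrite mulrDl divff ?gt_eqF // addrAC subrr add0r.
rewrite -[r / _]invf_div lnV ?posrE ?divr_gt0 // => h.
have := ler_wpM2l x0 h.
suff -> : t * ((x - r) ^+ 2 / r) = x * (t * (x - r) / r) - t * (x - r) by lra.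
by field; rewrite gt_eqF.
Qed.

(** * Limits along filters and ultrafilters *)

(** Compactness gives a cluster point. For each of its neighbourhoods, the ultrafilter contains the
    preimage or its complement, and the latter contradicts clustering. *)
Lemma ultra_bounded_cvg (R : realType) (T : Type) (U : set_system T)
    (f : T -> R) (a b : R) :
  UltraFilter U -> (forall t, a <= f t <= b) -> exists l : R, f t @[t --> U] --> l.
Proof.
move=> UU fab.
have [l [_ cl]] := @segment_compact R a b (f @ U) _
  (filterS (P := setT) (fun t _ => fab t) filterT).
exists l => N lN; have [//|UN] := in_ultra_setVsetC (f @^-1` N) UU.
by have [x [nNx Nx]] := cl (~` N) N UN lN.
Qed.

Lemma ultra_bounded_cV_cvg (R : realType) (M : nat) (T : Type)
    (U : set_system T) (f : T -> 'cV[R]_M) (a b : R) :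
  UltraFilter U -> (forall t j, a <= f t j 0 <= b) ->
  exists l : 'cV[R]_M, forall j, f t j 0 @[t --> U] --> l j 0.
Proof.
move=> UU fab.
have /choice[l fl] : forall j, exists l : R, f t j 0 @[t --> U] --> l.
  by move=> j; apply: (@ultra_bounded_cvg _ _ _ (fun t => f t j 0)).
by exists (\col_j l j) => j; rewrite mxE.
Qed.

Lemma cvgr_unique (R : realType) (T : Type) (F : set_system T)
    {FF : ProperFilter F} (f : T -> R) (a b : R) :
  f t @[t --> F] --> a -> f t @[t --> F] --> b -> a = b.
Proof. by apply: cvg_unique; exact: Rhausdorff. Qed.

Lemma cvgr_le_le (R : realType) (T : Type) (F : set_system T)
    {FF : ProperFilter F} (f g : T -> R) (a b : R) :
  f t @[t --> F] --> a -> g t @[t --> F] --> b -> (forall t, f t <= g t) ->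
  a <= b.
Proof.
move=> fa gb fg; rewrite leNgt; apply/negP => ba.
pose c := (a + b) / 2.
have ca : c < a by rewrite /c; lra.
have bc : b < c by rewrite /c; lra.
have [t [? ?]] := filter_ex (filterI (cvgr_gt _ fa _ ca) (cvgr_lt _ gb _ bc)).
by have := fg t; lra.
Qed.

Lemma cvgr_sum (R : realType) (T : Type) (F : set_system T) {FF : Filter F}
    (I : Type) (r : seq I) (P : pred I) (f : I -> T -> R) (l : I -> R) :
  (forall i, f i t @[t --> F] --> l i) ->
  \sum_(i <- r | P i) f i t @[t --> F] --> \sum_(i <- r | P i) l i.
Proof. by move=> fl; apply: cvg_big => //; exact: add_continuous. Qed.

Lemma cvg_mulmx_col (R : realType) (m M : nat) (T : Type) (F : set_system T)
    {FF : Filter F} (A : 'M[R]_(m, M)) (f : T -> 'cV[R]_M) (l : 'cV[R]_M) :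
  (forall j, f t j 0 @[t --> F] --> l j 0) ->
  forall i, (A *m f t) i 0 @[t --> F] --> (A *m l) i 0.
Proof.
move=> fl i; under eq_fun do rewrite mxE; rewrite mxE.
by apply: cvgr_sum => j; exact: cvgMl_tmp.
Qed.

(** Lower semicontinuity in the first argument, phrased through a convergent minorant so that no
    limit of x ln x at 0 is taken. The minorant is the Hellinger term if [l = 0], and the tangent of
    [kl] at [l] otherwise. *)
Lemma kl_lsc (R : realType) (T : Type) (F : set_system T) {FF : ProperFilter F}
    (f : T -> R) (l y : R) :
  f t @[t --> F] --> l -> (forall t, 0 <= f t) -> 0 <= y ->
  (forall t, 0 < f t -> 0 < y) ->
  exists2 g : T -> R, g t @[t --> F] --> kl l y & forall t, g t <= kl (f t) y.
Proof.
move=> fl f0 y0 fy; have : 0 <= l by exact: cvgr_le_le (cvg_cst 0) fl f0.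
rewrite le_eqVlt => /predU1P[l0|l0].
  pose h t := Num.sqrt (f t) - Num.sqrt y.
  exists (h \* h); last first.
    by move=> t /=; rewrite -expr2 hellinger_le_kl // => /fy.
  have -> : kl l y = (Num.sqrt l - Num.sqrt y) * (Num.sqrt l - Num.sqrt y).
    by rewrite -l0 kl0 sqrtr0 sub0r mulrNN -expr2 sqr_sqrtr.
  have hl : h t @[t --> F] --> Num.sqrt l - Num.sqrt y.
    by apply: cvgB; [apply: continuous_cvg fl; exact: sqrt_continuous|
      exact: cvg_cst].
  exact: (cvgM hl hl).
exists (fun t => f t * ln (l / y) + y - l); last first.
  move=> t; have := @kl_ge0 R (f t) l (f0 t) (ltW l0) (fun=> l0).
  by rewrite (@kl_subr _ (f t) l y) //; [lra|exact: fy].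
have -> : kl l y = l * ln (l / y) + y - l by rewrite /kl addrAC.
by apply: cvgB; [apply: cvgD; [apply: cvgMr_tmp|]|]; (try exact: cvg_cst).
Qed.

(** * Information projections onto affine slices of the simplex *)

Definition nonneg (R : realType) (M : nat) (x : 'cV[R]_M) : Prop :=
  forall j, 0 <= x j 0.

Definition dominated (R : realType) (M : nat) (x y : 'cV[R]_M) : Prop :=
  forall j, 0 < x j 0 -> 0 < y j 0.

(* [KL] as a real number, meaningful only for [dominated x y]. *)
Definition Kl (R : realType) (M : nat) (x y : 'cV[R]_M) : R :=
  \sum_j kl (x j 0) (y j 0).

Lemma entry_le_sum (R : realType) (M : nat) (x : 'cV[R]_M) (j : 'I_M) :
  nonneg x -> x j 0 <= \sum_k x k 0.
Proof.
move=> x0; rewrite (bigD1 j) //= lerDl sumr_ge0 // => k _; exact: x0.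
Qed.

Lemma dominated_trans (R : realType) (M : nat) (y x z : 'cV[R]_M) :
  dominated x y -> dominated y z -> dominated x z.
Proof. by move=> xy yz j /xy /yz. Qed.

Lemma KL_Kl (R : realType) (M : nat) (x y : 'cV[R]_M) :
  nonneg x -> nonneg y -> dominated x y -> KL x y = (Kl x y)%:E.
Proof.
move=> x0 y0 xy; rewrite /KL ifT //; apply/forallP => j.
rewrite x0 y0 /=; apply/implyP => /eqP yj.
by move: (x0 j); rewrite le_eqVlt eq_sym => /orP[//|/xy]; rewrite yj ltxx.
Qed.

Lemma KL_le_dominated (R : realType) (M : nat) (x y : 'cV[R]_M) (c : R) :
  (KL x y <= c%:E)%E -> dominated x y.
Proof.
rewrite /KL; case: ifP => [/forallP h _ j|]; last by rewrite leye_eq.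
have /and3P[_ y0 /implyP yx] := h j.
by move: y0; rewrite le_eqVlt eq_sym => /orP[/yx/eqP->|//]; rewrite ltxx.
Qed.

Lemma Kl_ge0 (R : realType) (M : nat) (x y : 'cV[R]_M) :
  nonneg x -> nonneg y -> dominated x y -> 0 <= Kl x y.
Proof. by move=> x0 y0 xy; apply: sumr_ge0 => j _; apply: kl_ge0 => // /xy. Qed.

Lemma kl_le_Kl (R : realType) (M : nat) (x y : 'cV[R]_M) (j : 'I_M) :
  nonneg x -> nonneg y -> dominated x y -> kl (x j 0) (y j 0) <= Kl x y.
Proof.
move=> x0 y0 xy; rewrite /Kl (bigD1 j) //= lerDl sumr_ge0 // => i _.
by apply: kl_ge0 => // /xy.
Qed.

Lemma Kl_eq0 (R : realType) (M : nat) (x y : 'cV[R]_M) :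
  nonneg x -> nonneg y -> dominated x y -> Kl x y = 0 -> x = y.
Proof.
move=> x0 y0 xy e; apply/colP => j; apply: kl_eq0 => //; first exact: xy.
apply: le_anti; rewrite -{1}e kl_le_Kl //=; apply: kl_ge0 => //; exact: xy.
Qed.

Lemma Klxx (R : realType) (M : nat) (x : 'cV[R]_M) : Kl x x = 0.
Proof. by rewrite /Kl big1 // => j _; rewrite klxx. Qed.

Lemma Kl_subr (R : realType) (M : nat) (x r y : 'cV[R]_M) :
  nonneg x -> dominated x r -> dominated x y ->
  Kl x y = Kl x r + \sum_j (x j 0 * ln (r j 0 / y j 0) + y j 0 - r j 0).
Proof.
move=> x0 xr xy; rewrite /Kl -big_split /=; apply: eq_bigr => j _.
rewrite (@kl_subr _ _ (r j 0)) //; [ring|exact: xr|exact: xy].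
Qed.

(** The parameter [t] is not confined to [0, 1]: lines may be prolonged as long as the entries stay
    nonnegative. Closedness is stated for filters so that it applies to ultralimits. *)
Definition affine_slice (R : realType) (M : nat) (D : set 'cV[R]_M) : Prop :=
  [/\ D `<=` @simplex R M,
      forall x y t, D x -> D y -> nonneg (x + t *: (y - x)) ->
        D (x + t *: (y - x)) &
      forall (F : set_system nat) (u : nat -> 'cV[R]_M) (l : 'cV[R]_M),
        ProperFilter F -> (forall k, D (u k)) ->
        (forall j, u k j 0 @[k --> F] --> l j 0) -> D l].

(** Domination stands for finiteness of the divergence, so competitors at infinite divergence are
    left out. *)
Definition Kl_minimizer (R : realType) (M : nat) (D : set 'cV[R]_M)
    (p r : 'cV[R]_M) : Prop :=
  [/\ D r, dominated r p & forall s, D s -> dominated s p -> Kl r p <= Kl s p].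

Section Minimizer.
Variables (R : realType) (M : nat) (D : set 'cV[R]_M) (p : 'cV[R]_M).
Hypotheses (sliceD : affine_slice D) (p0 : nonneg p).

Let Dnonneg x : D x -> nonneg x.
Proof. by case: sliceD => + _ _ => /[apply] -[]. Qed.

Let segment (r x : 'cV[R]_M) t j :
  (r + t *: (x - r)) j 0 = r j 0 + t * (x j 0 - r j 0).
Proof. by rewrite !mxE. Qed.

Let segment_ge0 (r x : 'cV[R]_M) t :
  D r -> D x -> 0 < t < 1 -> nonneg (r + t *: (x - r)).
Proof.
move=> /Dnonneg r0 /Dnonneg x0 /andP[t0 t1] j.
have -> : (r + t *: (x - r)) j 0 = (1 - t) * r j 0 + t * x j 0.
  by rewrite segment; ring.
by rewrite addr_ge0 // mulr_ge0 // ?subr_ge0 ltW.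
Qed.

Let dominated_segment (r x : 'cV[R]_M) t :
  D r -> D x -> 0 < t < 1 -> dominated x (r + t *: (x - r)).
Proof.
move=> /Dnonneg r0 /Dnonneg x0 /andP[t0 t1] j xj.
have -> : (r + t *: (x - r)) j 0 = (1 - t) * r j 0 + t * x j 0.
  by rewrite segment; ring.
by rewrite ltr_wpDl // ?mulr_gt0 // mulr_ge0 // subr_ge0 ltW.
Qed.

(* Convexity along the segment from [r] to [x], in the form of
   [kl_convex_combination], leaves the term [Kl x z] to spare. *)
Let Kl_segment_le r x t : Kl_minimizer D p r -> D x -> dominated x p -> 0 < t < 1 ->
  Kl x (r + t *: (x - r)) <= Kl x p - Kl r p.
Proof.
move=> [Dr rp rmin] Dx xp t01; have /andP[t0 t1] := t01.
have [r0 x0] := (Dnonneg Dr, Dnonneg Dx).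
set z := r + _; have z0 : nonneg z by exact: segment_ge0.
have Dz : D z by case: sliceD => _ + _; apply.
have zp : dominated z p.
  move=> j; rewrite segment => zj.
  move: (r0 j); rewrite le_eqVlt => /predU1P[rj|/rp //].
  move: (x0 j); rewrite le_eqVlt => /predU1P[xj|/xp //].
  by move: zj; rewrite -rj -xj subr0 mulr0 addr0 ltxx.
have rz : dominated r z.
  move=> j rj; have -> : z j 0 = (1 - t) * r j 0 + t * x j 0.
    by rewrite segment; ring.
  by rewrite ltr_pwDl // ?mulr_gt0 ?mulr_ge0 ?subr_gt0 // ltW.
have E : (1 - t) * Kl r p + t * Kl x p = Kl z p + (1 - t) * Kl r z + t * Kl x z.
  rewrite /Kl !mulr_sumr -!big_split /=; apply: eq_bigr => j _.
  rewrite segment; apply: kl_convex_combination => //; [exact: rp|exact: xp].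
have zmin := rmin z Dz zp.
(* Drop this term from [E], bound [Kl z p] below by [Kl r p], and divide by [t]. *)
have : 0 <= (1 - t) * Kl r z.
  by rewrite mulr_ge0 ?Kl_ge0 // subr_ge0 ltW.
have : t * Kl x z <= t * (Kl x p - Kl r p) -> Kl x z <= Kl x p - Kl r p.
  by rewrite ler_pM2l.
by move=> h ?; apply: h; lra.
Qed.

(** If [r] vanished at an index where [x] does not, the divergence from [x] to the segment point
    would grow like - ln t there, against the uniform bound of [Kl_segment_le]. *)
Let minimizer_dominates r x : Kl_minimizer D p r -> D x -> dominated x p ->
  dominated x r.
Proof.
move=> rmin Dx xp j xj; have [Dr _ _] := rmin.
have := Dnonneg Dr j; rewrite le_eqVlt => /predU1P[rj|//]; exfalso.
(* With this [t], the [j]-th term equals |c| + x_j + t x_j, which exceeds [c]. *)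
pose c := Kl x p - Kl r p; pose t := expR (- (`|c| / x j 0 + 2)).
have a0 : 0 <= `|c| / x j 0 by rewrite divr_ge0 // ltW.
have t01 : 0 < t < 1 by rewrite expR_gt0 expR_lt1; lra.
have z0 := segment_ge0 Dr Dx t01.
have xz := dominated_segment Dr Dx t01.
have := le_trans (kl_le_Kl j (Dnonneg Dx) z0 xz) (Kl_segment_le rmin Dx xp t01).
rewrite segment -rj subr0 add0r -/c /kl invfM mulrCA divff ?gt_eqF // mulr1.
rewrite -expRN opprK expRK mulrDr mulrCA divff ?gt_eqF // mulr1.
have := ler_norm c; have /andP[? _] := t01.
have : 0 < t * x j 0 by rewrite mulr_gt0.
lra.
Qed.

(** The limit of [Kl_segment_le] as [t] tends to 0, with the error controlled by [kl_near_ge]. *)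
Let Kl_pythagoras_le r x : Kl_minimizer D p r -> D x -> dominated x p ->
  Kl x r + Kl r p <= Kl x p.
Proof.
move=> rmin Dx xp; have [Dr _ _] := rmin.
have xr := minimizer_dominates rmin Dx xp.
have [r0 x0] := (Dnonneg Dr, Dnonneg Dx).
pose B := \sum_j ((x j 0 - r j 0) ^+ 2 / r j 0).
have B0 : 0 <= B.
  by apply: sumr_ge0 => j _; rewrite divr_ge0 ?sqr_ge0.
have h t : 0 < t < 1 -> Kl x r - t * B <= Kl x p - Kl r p.
  move=> t01; apply: le_trans (Kl_segment_le rmin Dx xp t01).
  rewrite /Kl /B mulr_sumr -sumrB; apply: ler_sum => j _.
  by rewrite segment; apply: kl_near_ge => //; exact: xr.
rewrite -lerBrDr leNgt; apply/negP => lt.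
have [c c0 cE] : exists2 c, 0 < c & Kl x r = c + (Kl x p - Kl r p).
  by exists (Kl x r - (Kl x p - Kl r p)); rewrite ?subr_gt0 ?subrK.
have d0 : 0 < B + c + 1 by rewrite addr_gt0 // ltr_wpDl.
(* Chosen so that [t] is below 1 and t B stays below the supposed excess [c]. *)
have t01 : 0 < c / (B + c + 1) < 1.
  by rewrite divr_gt0 //= ltr_pdivrMr //; lra.
have := h _ t01.
have : c / (B + c + 1) * B < c.
  by rewrite mulrAC ltr_pdivrMr // ltr_pM2l //; lra.
by rewrite cE; lra.
Qed.

(* By domination the segment from [x] to the minimizer [r] extends beyond [r]
   inside [D], and the defect of the inequality is affine along it. *)
Lemma Kl_pythagoras r x : Kl_minimizer D p r -> D x -> dominated x p ->
  dominated x r /\ Kl x p = Kl x r + Kl r p.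
Proof.
move=> rmin Dx xp; have [Dr rp _] := rmin.
have xr := minimizer_dominates rmin Dx xp.
split=> //; apply: le_anti; rewrite Kl_pythagoras_le // andbT.
have [r0 x0] := (Dnonneg Dr, Dnonneg Dx).
have [s s0 sr] : exists2 s : R, 0 < s &
    forall j, s * (x j 0 - r j 0) <= r j 0.
  (* The step length is the least positive entry of [r], capped at 1. It suffices because x_j <= 1,
     and because [x] vanishes wherever [r] does. *)
  have [e e0 er] : exists2 e : R, 0 < e & forall j, 0 < r j 0 -> e <= r j 0.
    exists (\big[Num.min/1]_(j | 0 < r j 0) r j 0).
      by apply: lt_bigmin.
    by move=> j rj; exact: bigmin_le_cond.
  have x1 j : x j 0 <= 1.
    by case: sliceD => sub _ _; have [_ <-] := sub _ Dx; exact: entry_le_sum.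
  exists e => // j; move: (r0 j); rewrite le_eqVlt => /predU1P[rj|rj].
    have -> : x j 0 = 0.
      by apply: le_anti; rewrite x0 andbT leNgt; apply/negP => /xr; rewrite -rj ltxx.
    by rewrite -rj subr0 mulr0.
  apply: le_trans (er j rj); rewrite -[leRHS]mulr1 ler_pM2l //.
  by have := x1 j; have := r0 j; lra.
pose y := r + (- s) *: (x - r).
have yE j : y j 0 = r j 0 + (- s) * (x j 0 - r j 0) by rewrite segment.
have y0 : nonneg y by move=> j; rewrite yE; have := sr j; lra.
have Dy : D y by case: sliceD => _ + _; apply.
have yr : dominated y r.
  move=> j; rewrite yE => yj; move: (r0 j); rewrite le_eqVlt => /predU1P[rj|//].
  have xj : x j 0 = 0.
    by apply: le_anti; rewrite x0 andbT leNgt; apply/negP => /xr; rewrite -rj ltxx.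
  by move: yj; rewrite xj -rj subr0 mulr0 addr0 ltxx.
have yp := dominated_trans yr rp.
pose L (z : 'cV[R]_M) := \sum_j (z j 0 * ln (r j 0 / p j 0) + p j 0 - r j 0).
have LE z : nonneg z -> dominated z r -> Kl z p = Kl z r + L z.
  by move=> z0 zr; apply: Kl_subr => //; exact: dominated_trans zr rp.
(* At [y] the inequality reads L r <= L y = L r - s (L x - L r), hence L x <= L r, which is the
   reverse inequality at [x]. *)
have := Kl_pythagoras_le rmin Dy yp.
rewrite (LE r) // Klxx add0r (LE y) // lerD2l (LE x) // lerD2l.
have -> : L y = L r - s * (L x - L r).
  rewrite /L -sumrB mulr_sumr -sumrB; apply: eq_bigr => j _; rewrite yE; ring.
move=> h; have : s * (L x - L r) <= 0 by lra.
by rewrite pmulr_rle0 // subr_le0.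
Qed.

(** The direct method: an ultralimit of a minimizing sequence stays in [D] by closedness, and lower
    semicontinuity makes it optimal. *)
Lemma Kl_minimizer_exists x : D x -> dominated x p -> exists r, Kl_minimizer D p r.
Proof.
move=> Dx xp.
pose S := [set Kl s p | s in [set s | D s /\ dominated s p]].
have Sinf : has_inf S.
  split; first by exists (Kl x p); exists x.
  by exists 0 => _ [s [Ds sp] <-]; apply: Kl_ge0 => //; apply: Dnonneg.
have /choice[u uP] : forall k : nat, exists s,
    [/\ D s, dominated s p & Kl s p <= inf S + harmonic k].
  move=> k; have k0 : 0 < harmonic k :> R by rewrite /harmonic /= invr_gt0 ltr0n.
  by have [_ [s [Ds sp] <-] /ltW ?] := inf_adherent k0 Sinf; exists s.
have [U [UU ooU]] := ultraFilterLemma (@eventually_filter).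
have UF : ProperFilter U by exact: ultra_proper.
have u01 k j : 0 <= u k j 0 <= 1.
  have [Du _ _] := uP k; rewrite Dnonneg //=.
  by case: sliceD => sub _ _; have [u0 <-] := sub _ Du; exact: entry_le_sum.
have [r ur] := ultra_bounded_cV_cvg UU u01.
have Dr : D r.
  case: sliceD => _ _ Dclosed; apply: (Dclosed U u r UF _ ur) => k.
  by case: (uP k).
(* Where [p] vanishes, every member of the minimizing sequence vanishes, hence so does the limit. *)
have rp : dominated r p.
  move=> j rj; have := p0 j; rewrite le_eqVlt => /predU1P[pj|//].
  suff e : r j 0 = 0 by move: rj; rewrite e ltxx.
  apply: cvgr_unique (ur j) _.
  rewrite (_ : (fun k => _) = fun=> 0); first exact: cvg_cst.
  apply/funext => k; have [_ up _] := uP k; have /andP[u0 _] := u01 k j.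
  by apply: le_anti; rewrite u0 andbT leNgt; apply/negP => /up; rewrite -pj ltxx.
exists r; split=> // s Ds sp; apply: (@le_trans _ _ (inf S)); last first.
  by apply: ge_inf; [case: Sinf|exists s].
have /choice[g gP] : forall j, exists g : nat -> R,
    g k @[k --> U] --> kl (r j 0) (p j 0) /\ forall k, g k <= kl (u k j 0) (p j 0).
  move=> j; have uj0 k : 0 <= u k j 0 by case/andP: (u01 k j).
  have ujp k : 0 < u k j 0 -> 0 < p j 0 by have [_ + _] := uP k; apply.
  by have [g gl gle] := kl_lsc (ur j) uj0 (p0 j) ujp; exists g.
have gK : \sum_j g j k @[k --> U] --> Kl r p.
  by apply: cvgr_sum => j; case: (gP j).
have SK : inf S + harmonic k @[k --> U] --> inf S.
  rewrite -[in X in _ --> X](addr0 (inf S)); apply: cvgD; first exact: cvg_cst.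
  by apply: cvg_trans cvg_harmonic; exact: cvg_app ooU.
apply: cvgr_le_le gK SK _ => k; have [_ _ uS] := uP k.
by apply: le_trans uS; apply: ler_sum => j _; case: (gP j).
Qed.

(** Another minimizer [s] has finite divergence, and the Pythagorean identity then forces
    [Kl s r = 0]. *)
Lemma KLargmin_unique r : Kl_minimizer D p r -> KLargmin D p = [set r].
Proof.
move=> rmin; have [Dr rp rle] := rmin.
have r0 := Dnonneg Dr; apply/seteqP; split=> [s [Ds sle]|_ ->].
  have := sle _ Dr; rewrite (KL_Kl r0) // => /[dup] /KL_le_dominated sp.
  have s0 := Dnonneg Ds; rewrite (KL_Kl s0) // lee_fin.
  have [sr ->] := Kl_pythagoras rmin Ds sp.
  rewrite gerDr => Kle; apply: Kl_eq0 => //; apply: le_anti.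
  by rewrite Kle Kl_ge0.
split=> // s Ds; rewrite (KL_Kl r0) //.
have [sp|nsp] := pselect (dominated s p).
  by rewrite KL_Kl ?lee_fin; [exact: rle|exact: Dnonneg|..].
apply: contrapT => /negP; rewrite -ltNge => /ltW /KL_le_dominated.
exact: nsp.
Qed.

Lemma KLprojP x : D x -> dominated x p ->
  Kl_minimizer D p (KLproj D p) /\ KLargmin D p = [set KLproj D p].
Proof.
move=> Dx xp; have [r rmin] := Kl_minimizer_exists Dx xp.
have e := KLargmin_unique rmin.
suff -> : KLproj D p = r by [].
have : KLargmin D p (KLproj D p) by apply: xgetPex; exists r; rewrite e.
by rewrite e.
Qed.

End Minimizer.

(** * The multiplicative step and the normalization *)

Definition normalized (R : realType) (m M : nat) (A : 'M[R]_(m, M))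
    (b : 'cV[R]_m) : Prop :=
  [/\ forall i j, 0 <= A i j, forall j, \sum_i A i j = 1, nonneg b &
      \sum_i b i 0 = 1].

(** Weighted AM-GM. For positive mean [S], bound each ln r_i by its tangent at [S]; the weighted
    bounds sum to ln S. For [S = 0] some positive weight sits on a zero [r i], which kills the
    product. *)
Lemma prod_powR_le_sum (R : realType) (m : nat) (a r : 'I_m -> R) :
  (forall i, 0 <= a i) -> \sum_i a i = 1 -> (forall i, 0 <= r i) ->
  \prod_i (r i `^ a i) <= \sum_i a i * r i.
Proof.
move=> a0 a1 r0; set S := \sum_i _.
have : 0 <= S by apply: sumr_ge0 => i _; rewrite mulr_ge0.
rewrite le_eqVlt => /predU1P[S0|S0].
  have [i ai] : exists i, 0 < a i.
    apply: contrapT => na; have : \sum_i a i = 0.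
      apply: big1 => i _; apply: le_anti; rewrite a0 andbT leNgt.
      by apply/negP => ai; apply: na; exists i.
    by rewrite a1 => /eqP; rewrite oner_eq0.
  have ar0 k : true -> 0 <= a k * r k by move=> _; rewrite mulr_ge0.
  have /(_ i isT)/eqP := psumr_eq0P ar0 (esym S0).
  rewrite mulf_eq0 gt_eqF //= => /eqP ri.
  by rewrite (bigD1 i) //= ri powR0 ?gt_eqF // mul0r -S0.
have le1 i : r i `^ a i <= expR (a i * (r i / S - 1 + ln S)).
  have := r0 i; rewrite le_eqVlt => /predU1P[<-|ri].
    rewrite /powR eqxx; case: eqP => [->|_]; last exact: expR_ge0.
    by rewrite mul0r expR0.
  rewrite /powR gt_eqF // ler_expR ler_wpM2l //.
  have := ln_le_sub1 (divr_gt0 ri S0); rewrite ln_div ?posrE //; lra.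
apply: (@le_trans _ _ (\prod_i expR (a i * (r i / S - 1 + ln S)))).
  by apply: ler_prod => i _; rewrite powR_ge0 le1.
rewrite -expR_sum (_ : \sum_i _ = ln S) ?lnK ?posrE //.
rewrite (eq_bigr (fun i => a i * r i * S^-1 + a i * (ln S - 1))); last first.
  by move=> i _; ring.
by rewrite big_split /= -!mulr_suml a1 divff ?gt_eqF // mul1r addrC subrK.
Qed.

Lemma ln_prod (R : realType) (I : Type) (s : seq I) (f : I -> R) :
  (forall i, 0 < f i) -> ln (\prod_(i <- s) f i) = \sum_(i <- s) ln (f i).
Proof.
move=> f0; elim: s => [|i s IH]; first by rewrite !big_nil ln1.
rewrite !big_cons lnM ?posrE ?IH //; exact: prodr_gt0.
Qed.

Section MultStep.
Variables (R : realType) (m M : nat) (A : 'M[R]_(m, M)) (b : 'cV[R]_m).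
Hypothesis normAb : normalized A b.

Let A0 i j : 0 <= A i j. Proof. by case: normAb. Qed.
Let A1 j : \sum_i A i j = 1. Proof. by case: normAb. Qed.
Let b0 : nonneg b. Proof. by case: normAb. Qed.
Let b1 : \sum_i b i 0 = 1. Proof. by case: normAb. Qed.

Lemma sum_mulmx (p : 'cV[R]_M) : \sum_i (A *m p) i 0 = \sum_j p j 0.
Proof.
under eq_bigr do rewrite mxE; rewrite exchange_big /=; apply: eq_bigr => j _.
by rewrite -mulr_suml A1 mul1r.
Qed.

Lemma mulmx_ge0 (p : 'cV[R]_M) : nonneg p -> nonneg (A *m p).
Proof. by move=> p0 i; rewrite mxE sumr_ge0 // => j _; rewrite mulr_ge0. Qed.

Lemma mulmx_gt0 (p : 'cV[R]_M) i j : nonneg p -> 0 < A i j -> 0 < p j 0 ->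
  0 < (A *m p) i 0.
Proof.
move=> p0 Aij pj; rewrite mxE (bigD1 j) //= ltr_pwDl ?mulr_gt0 //.
by apply: sumr_ge0 => k _; rewrite mulr_ge0.
Qed.

Lemma ratio_ge0 (x y : R) : 0 <= x -> 0 <= y -> 0 <= Defs.ratio x y.
Proof. by move=> x0 y0; rewrite /Defs.ratio; case: ifP => // _; rewrite divr_ge0. Qed.

Lemma mult_step_ge0 (p : 'cV[R]_M) : nonneg p -> nonneg (mult_step A b p).
Proof.
by move=> p0 j; rewrite mxE mulr_ge0 // prodr_ge0 // => i _; rewrite powR_ge0.
Qed.

Lemma mult_step_le (p : 'cV[R]_M) j : nonneg p ->
  mult_step A b p j 0 <= p j 0 * \sum_i A i j * Defs.ratio (b i 0) ((A *m p) i 0).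
Proof.
move=> p0; rewrite mxE ler_wpM2l // prod_powR_le_sum // => i.
by rewrite ratio_ge0 // mulmx_ge0.
Qed.

(** After AM-GM and an exchange of sums, row [i] contributes (A p)_i times its ratio. This is b_i,
    also when (A p)_i = 0, by the second hypothesis. *)
Lemma sum_mult_step_le1 (p : 'cV[R]_M) : nonneg p ->
  (forall i, (A *m p) i 0 = 0 -> b i 0 = 0) ->
  \sum_j mult_step A b p j 0 <= 1.
Proof.
move=> p0 Apb; pose c i := Defs.ratio (b i 0) ((A *m p) i 0).
apply: (@le_trans _ _ (\sum_j p j 0 * \sum_i A i j * c i)).
  by apply: ler_sum => j _; exact: mult_step_le.
under eq_bigr do rewrite mulr_sumr; rewrite exchange_big /= -b1 le_eqVlt.
apply/orP; left; apply/eqP; apply: eq_bigr => i _.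
rewrite (eq_bigr (fun j => A i j * p j 0 * c i)).
  rewrite -mulr_suml (_ : \sum_j _ = (A *m p) i 0); last by rewrite mxE.
  have [e|ne] := eqVneq ((A *m p) i 0) 0; first by rewrite e mul0r Apb.
  by rewrite /c /Defs.ratio (negbTE ne) andbF mulrCA divff // mulr1.
by move=> j _; ring.
Qed.

Section Solution.
Variables (p x : 'cV[R]_M).
Hypotheses (p0 : nonneg p) (x0 : nonneg x) (Ax : A *m x = b)
  (xp : dominated x p).

(** A vanishing (A p)_i forces A_ij = 0 wherever p_j > 0, in particular on the support of [x]. Thus
    0 / 0 is the only quotient with zero denominator. *)
Lemma mulmx_eq0_rhs i : (A *m p) i 0 = 0 -> b i 0 = 0.
Proof.
rewrite mxE => /(psumr_eq0P (fun j _ => mulr_ge0 (A0 i j) (p0 j))) Ap.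
rewrite -Ax mxE big1 // => j _.
have := x0 j; rewrite le_eqVlt => /predU1P[<-|/xp pj]; first by rewrite mulr0.
have /eqP := Ap j erefl; rewrite mulf_eq0 (gt_eqF pj) orbF => /eqP ->.
by rewrite mul0r.
Qed.

Let factor_gt0 i j : 0 < x j 0 ->
  0 < Defs.ratio (b i 0) ((A *m p) i 0) `^ A i j.
Proof.
move=> xj; have := A0 i j; rewrite le_eqVlt => /predU1P[<-|Aij].
  by rewrite powRr0.
have bi : 0 < b i 0 by rewrite -Ax; exact: mulmx_gt0 Aij xj.
rewrite powR_gt0 // /Defs.ratio gt_eqF //= divr_gt0 //; exact: mulmx_gt0 Aij (xp xj).
Qed.

Lemma dominated_mult_step : dominated x (mult_step A b p).
Proof.
move=> j xj; rewrite mxE mulr_gt0 ?xp // prodr_gt0 // => i _; exact: factor_gt0.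
Qed.

Lemma Kl_mult_step :
  Kl x p = Kl x (mult_step A b p) + Kl b (A *m p)
           + (1 - \sum_j mult_step A b p j 0).
Proof.
rewrite (Kl_subr x0 dominated_mult_step xp) -addrA; congr (_ + _).
pose L i := ln (Defs.ratio (b i 0) ((A *m p) i 0)).
rewrite sumrB big_split /= [RHS]addrA; congr (_ - _).
(* The logarithm of the update is A^T applied to the log ratios; pairing it with [x] moves A across
   and yields A x = b. *)
have -> : \sum_j x j 0 * ln (mult_step A b p j 0 / p j 0) = \sum_i b i 0 * L i.
  rewrite (eq_bigr (fun j => \sum_i A i j * x j 0 * L i)); last first.
    move=> j _; have := x0 j; rewrite le_eqVlt => /predU1P[<-|xj].
      by rewrite mul0r big1 // => i _; rewrite mulr0 mul0r.
    have pj := xp xj.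
    rewrite mxE mulrAC divff ?gt_eqF // mul1r ln_prod; last first.
      by move=> i; exact: factor_gt0.
    by rewrite mulr_sumr; apply: eq_bigr => i _; rewrite ln_powR mulrCA mulrA.
  by rewrite exchange_big; apply: eq_bigr => i _; rewrite -Ax mxE mulr_suml.
rewrite -(sum_mulmx p) -b1 /Kl -!big_split /=; apply: eq_bigr => i _.
rewrite /L /kl /Defs.ratio; case: eqP => [->|_] /=; last by ring.
rewrite mul0r; ring.
Qed.

End Solution.

(* The upper bound [mult_step_le] converges to the limit of [p], and the total
   masses agree in the limit, which turns it into a lower bound. *)
Lemma mult_step_cvg (T : Type) (F : set_system T) {FF : ProperFilter F}
    (p : T -> 'cV[R]_M) (l : 'cV[R]_M) :
  (forall t, nonneg (p t)) ->
  (forall j, p t j 0 @[t --> F] --> l j 0) ->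
  (forall i, (A *m p t) i 0 @[t --> F] --> b i 0) ->
  \sum_j mult_step A b (p t) j 0 @[t --> F] --> (1 : R) ->
  forall j, mult_step A b (p t) j 0 @[t --> F] --> l j 0.
Proof.
move=> p0 pl Apb sum1.
have Al : A *m l = b.
  apply/colP => i; apply: cvgr_unique (Apb i); exact: cvg_mulmx_col.
(* Where b_i = 0 the ratio may jump between 0 and 1, so it is replaced by its upper bound 1. *)
pose h i t := if b i 0 == 0 then 1 else b i 0 / (A *m p t) i 0.
have h1 i : h i t @[t --> F] --> (1 : R).
  rewrite /h; case: eqP => [_|/eqP bi]; first exact: cvg_cst.
  by rewrite -(divff bi); apply: cvgMl_tmp; exact: cvgV.
pose u j t := p t j 0 * \sum_i A i j * h i t.
have ul j : u j t @[t --> F] --> l j 0.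
  rewrite -[l j 0]mulr1 -(A1 j); apply: cvgM => //; apply: cvgr_sum => i.
  by rewrite -[X in _ --> X]mulr1; apply: cvgMl_tmp; exact: h1.
have stepu j t : mult_step A b (p t) j 0 <= u j t.
  apply: le_trans (mult_step_le j (p0 t)) _.
  rewrite ler_wpM2l //; first exact: p0.
  apply: ler_sum => i _; rewrite ler_wpM2l // /Defs.ratio /h.
  by case: eqP => [->|//]; rewrite mul0r; case: ifP.
move=> j; pose v t := \sum_k mult_step A b (p t) k 0 - \sum_(k | k != j) u k t.
have vl : v t @[t --> F] --> l j 0.
  have -> : l j 0 = 1 - \sum_(k | k != j) l k 0.
    by rewrite -b1 -Al sum_mulmx (bigD1 j) //= addrK.
  by apply: cvgB => //; exact: cvgr_sum.
apply: squeeze_cvgr vl (ul j); apply: nearW => t; rewrite stepu andbT.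
by rewrite /v (bigD1 j) //= -addrA gerDl subr_le0 ler_sum.
Qed.

End MultStep.

(** * Properties of the normalized system *)

Section NormalizationFacts.
Variables (R : realType) (m M : nat) (A : 'M[R]_(m, M)) (b : 'cV[R]_m).

Lemma norm_A1_ge0 i j : 0 <= norm_A1 A b i j.
Proof.
rewrite mxE subr_ge0 /norm_shift; set s := _ ++ _.
apply: (@bigmin_inf_seq _ _ _ _ _ (A i j)) => //.
by rewrite mem_cat allpairs_f ?mem_enum.
Qed.

Lemma norm_b1_ge0 i : 0 <= norm_b1 A b i 0.
Proof.
rewrite mxE subr_ge0 /norm_shift; set s := _ ++ _.
apply: (@bigmin_inf_seq _ _ _ _ _ (b i 0)) => //.
by rewrite mem_cat; apply/orP; right; apply/mapP; exists i; rewrite ?mem_enum.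
Qed.

Lemma sum_norm_A1_le j : \sum_i norm_A1 A b i j <= norm_scale A b.
Proof. exact: le_bigmax. Qed.

Lemma sum_norm_b1_le : \sum_i norm_b1 A b i 0 <= norm_scale A b.
Proof. exact: bigmax_ge_id. Qed.

Lemma norm_scale_ge0 : 0 <= norm_scale A b.
Proof.
apply: le_trans sum_norm_b1_le; apply: sumr_ge0 => i _; exact: norm_b1_ge0.
Qed.

Lemma norm_A2_ge0 i j : 0 <= norm_A2 A b i j.
Proof.
rewrite /norm_A2; case: ifP => _; first exact: norm_A1_ge0.
by rewrite mxE mulr_ge0 ?invr_ge0 ?norm_scale_ge0 ?norm_A1_ge0.
Qed.

Lemma norm_b2_ge0 i : 0 <= norm_b2 A b i 0.
Proof.
rewrite /norm_b2; case: ifP => _; first exact: norm_b1_ge0.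
by rewrite mxE mulr_ge0 ?invr_ge0 ?norm_scale_ge0 ?norm_b1_ge0.
Qed.

Lemma sum_norm_A2_le1 j : \sum_i norm_A2 A b i j <= 1.
Proof.
have h := sum_norm_A1_le j; rewrite /norm_A2; case: eqP => [e|/eqP ne].
  by apply: le_trans h _; rewrite e.
under eq_bigr do rewrite mxE; rewrite -mulr_sumr mulrC ler_pdivrMr ?mul1r //.
by rewrite lt_neqAle eq_sym ne norm_scale_ge0.
Qed.

Lemma sum_norm_b2_le1 : \sum_i norm_b2 A b i 0 <= 1.
Proof.
have h := sum_norm_b1_le; rewrite /norm_b2; case: eqP => [e|/eqP ne].
  by apply: le_trans h _; rewrite e.
under eq_bigr do rewrite mxE; rewrite -mulr_sumr mulrC ler_pdivrMr ?mul1r //.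
by rewrite lt_neqAle eq_sym ne norm_scale_ge0.
Qed.

Lemma norm_rowsPn i : i \notin norm_rows A b ->
  (forall j, norm_A2 A b i j = 0) /\ norm_b2 A b i 0 = 0.
Proof.
rewrite inE negbK => /andP[/forallP A0 /eqP b0].
by split=> // j; apply/eqP.
Qed.

(** The deleted rows are zero, so the appended row still completes every sum to 1; it is nonnegative
    because the rescaled sums are at most 1. *)
Lemma normalized_norm : normalized (norm_A A b) (norm_b A b).
Proof.
split=> [i j|j|i|].
- rewrite mxE; case: (fintype.split _) => k; rewrite mxE ?norm_A2_ge0 // subr_ge0.
  exact: sum_norm_A2_le1.
- rewrite big_split_ord /= big_ord1.
  under eq_bigr do rewrite col_mxEu mxE.
  rewrite col_mxEd mxE -(big_enum_val (fun i => norm_A2 A b i j)) /=.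
  rewrite addrC [X in _ - X](bigID (mem (norm_rows A b))) /=.
  rewrite [X in _ - (_ + X)]big1 ?addr0 ?subrK // => i ir.
  by have [A0 b0] := norm_rowsPn ir.
- rewrite mxE; case: (fintype.split _) => k; rewrite mxE ?norm_b2_ge0 // subr_ge0.
  exact: sum_norm_b2_le1.
- rewrite big_split_ord /= big_ord1.
  under eq_bigr do rewrite col_mxEu mxE.
  rewrite col_mxEd mxE -(big_enum_val (fun i => norm_b2 A b i 0)) /=.
  rewrite addrC [X in _ - X](bigID (mem (norm_rows A b))) /=.
  rewrite [X in _ - (_ + X)]big1 ?addr0 ?subrK // => i ir.
  by have [A0 b0] := norm_rowsPn ir.
Qed.

Let mulmx_A1 (x : 'cV[R]_M) i : \sum_j x j 0 = 1 ->
  (norm_A1 A b *m x) i 0 - norm_b1 A b i 0 = (A *m x) i 0 - b i 0.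
Proof.
move=> x1; rewrite !mxE; under eq_bigr do rewrite mxE mulrBl.
by rewrite sumrB -mulr_sumr x1; ring.
Qed.

Let mulmx_A2 (x : 'cV[R]_M) :
  (norm_A2 A b *m x = norm_b2 A b) <-> (norm_A1 A b *m x = norm_b1 A b).
Proof.
rewrite /norm_A2 /norm_b2; case: eqP => // /eqP ne.
rewrite -scalemxAl; split=> [|-> //]; apply: scalerI.
by rewrite invr_eq0.
Qed.

Let mulmx_A1_eq (x : 'cV[R]_M) : \sum_j x j 0 = 1 ->
  (norm_A1 A b *m x = norm_b1 A b) <-> (A *m x = b).
Proof.
move=> x1; split=> e; apply/colP => i; apply/eqP; rewrite -subr_eq0.
  by rewrite -mulmx_A1 // e subrr.
by rewrite mulmx_A1 // e subrr.
Qed.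

(** On vectors of mass 1 the shift cancels on both sides. Rescaling is invertible, deleted rows read
    0 = 0, and the appended equation follows by summing the others. *)
Lemma norm_mulmx (x : 'cV[R]_M) : \sum_j x j 0 = 1 ->
  (norm_A A b *m x = norm_b A b) <-> (A *m x = b).
Proof.
move=> x1; rewrite -mulmx_A1_eq // -mulmx_A2 /norm_A /norm_b mul_col_mx.
split=> [/eq_col_mx[/colP e _]|e].
  apply/colP => i; have [ir|/norm_rowsPn[A0 b0]] := boolP (i \in norm_rows A b).
    have := e (enum_rank_in ir i); rewrite !mxE enum_rankK_in // => <-.
    by apply: eq_bigr => j _; rewrite mxE enum_rankK_in.
  by rewrite b0 mxE big1 // => j _; rewrite A0 mul0r.
congr col_mx; apply/colP => i; rewrite !mxE.
  by rewrite -e mxE; apply: eq_bigr => j _; rewrite mxE.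
rewrite -e; under eq_bigr do rewrite mxE mulrBl mul1r.
rewrite sumrB x1; congr (_ - _).
under eq_bigr do rewrite mulr_suml; rewrite exchange_big /=.
by apply: eq_bigr => k _; rewrite mxE.
Qed.

End NormalizationFacts.

(** * Convergence of the iteration *)

Lemma constraint_set_slice (R : realType) (m M : nat) (A : 'M[R]_(m, M))
    (b : 'cV[R]_m) : affine_slice (constraint_set A b).
Proof.
split=> [x [] //|x y t [[x0 x1] Ax] [[y0 y1] Ay] z0|F u l FF uC ul].
  split; last by rewrite mulmxDr -scalemxAr mulmxBr Ax Ay subrr scaler0 addr0.
  split=> //; under eq_bigr do rewrite !mxE.
  by rewrite big_split /= -mulr_sumr sumrB x1 y1 subrr mulr0 addr0.
split; first split.
- move=> j; apply: cvgr_le_le (cvg_cst 0) (ul j) _ => k.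
  by have [[u0 _] _] := uC k.
- apply: (@cvgr_unique _ _ F _ (fun k => \sum_j u k j 0)).
    exact: cvgr_sum.
  rewrite (_ : (fun k => _) = fun=> 1); first exact: cvg_cst.
  by apply/funext => k; have [[_ u1] _] := uC k.
- apply/colP => i; apply: (@cvgr_unique _ _ F _ (fun k => (A *m u k) i 0)).
    exact: cvg_mulmx_col.
  rewrite (_ : (fun k => _) = fun=> b i 0); first exact: cvg_cst.
  by apply/funext => k; have [_ ->] := uC k.
Qed.

(** The index [i0] keeps the intersection inside the simplex, which an empty family would not. *)
Lemma bigcap_slice (R : realType) (M : nat) (I : Type) (i0 : I)
    (D : I -> set 'cV[R]_M) :
  (forall i, affine_slice (D i)) -> affine_slice (\bigcap_i D i).
Proof.
move=> sD; split=> [x Dx|x y t Dx Dy z0 i _|F u l FF uD ul i _].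
- by case: (sD i0) => sub _ _; apply: sub; exact: Dx.
- by case: (sD i) => _ line _; apply: line => //; [exact: Dx|exact: Dy].
- by case: (sD i) => _ _ closed; apply: (closed F u) => // k; exact: uD.
Qed.

Lemma cvg_col (R : realType) (M : nat) (T : Type) (F : set_system T)
    {FF : Filter F} (f : T -> 'cV[R]_M) (l : 'cV[R]_M) :
  (forall j, f t j 0 @[t --> F] --> l j 0) -> f t @[t --> F] --> l.
Proof.
move=> fl; apply/cvg_ballP => e e0.
have : \forall t \near F, forall j, ball (l j 0) e (f t j 0).
  by apply: filter_forall => j; move/cvg_ballP: (fl j); apply.
apply: filterS => t h; split=> // j k; rewrite ord1; exact: h.
Qed.

Lemma cvg_sqr_le (R : realType) (T : Type) (F : set_system T) {FF : Filter F}
    (f g : T -> R) (l c : R) : 0 < c ->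
  (forall t, (l - f t) ^+ 2 <= c * g t) -> g t @[t --> F] --> (0 : R) ->
  f t @[t --> F] --> l.
Proof.
move=> c0 fg gl; apply/cvgrPdist_lt => e e0.
have ec : 0 < e ^+ 2 / c by rewrite divr_gt0 ?exprn_gt0.
have : \forall t \near F, g t < e ^+ 2 / c by exact: (cvgr_lt _ gl _ ec).
apply: filterS => t gt.
rewrite -(@ltr_pXn2r _ 2) ?nnegrE ?normr_ge0 ?(ltW e0) // real_normK ?num_real //.
by apply: le_lt_trans (fg t) _; rewrite mulrC -ltr_pdivlMr.
Qed.

(** For l > 0 the divergence is squeezed between 0 and the chi-square term (l - f)^2 / f; for l = 0
    it is [f] itself. *)
Lemma kl_cvg0 (R : realType) (T : Type) (F : set_system T) {FF : ProperFilter F}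
    (f : T -> R) (l : R) :
  0 <= l -> (forall t, 0 <= f t) -> (forall t, 0 < l -> 0 < f t) ->
  f t @[t --> F] --> l -> kl l (f t) @[t --> F] --> (0 : R).
Proof.
rewrite le_eqVlt => /predU1P[<-|l0] f0 lf fl.
  by under eq_fun do rewrite kl0.
have up : (l - f t) * (l - f t) * (f t)^-1 @[t --> F] --> (0 : R).
  have -> : 0 = (l - l) * (l - l) * l^-1 by rewrite subrr !mul0r.
  have dl : l - f t @[t --> F] --> l - l by apply: cvgB => //; exact: cvg_cst.
  by apply: cvgM; [exact: (cvgM dl dl)|apply: cvgV; rewrite ?gt_eqF].
apply: squeeze_cvgr (cvg_cst 0) up; apply: nearW => t.
have ft := lf t l0; rewrite kl_ge0 //=; last exact: ltW.
have := ler_wpM2l (ltW l0) (ln_le_sub1 (divr_gt0 l0 ft)).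
suff -> : (l - f t) * (l - f t) * (f t)^-1 = l * (l / f t - 1) - l + f t.
  by rewrite /kl; lra.
by field; rewrite gt_eqF.
Qed.

(** * The iterates and their loss of divergence *)

Section Iteration.
Variables (R : realType) (M n : nat) (hn : (0 < n)%N) (q : 'cV[R]_M).
Hypothesis hq : forall j, 0 < q j 0.
Variables (m : 'I_n -> nat).
Variables (A : forall k, 'M[R]_(m k, M)) (b : forall k, 'cV[R]_(m k)).
Variable (I_GIS : {set 'I_n}).

Let Ck i := constraint_set (A i) (b i).
Let C := \bigcap_i Ck i.
Let Ah i := norm_A (A i) (b i).
Let bh i := norm_b (A i) (b i).
Let p := iterate hn A b I_GIS q.

Hypothesis hC : C !=set0.

Let sliceC : affine_slice C.
Proof. by apply: (bigcap_slice (cyc hn 0)) => i; exact: constraint_set_slice. Qed.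

Let Cnonneg x : C x -> nonneg x.
Proof. by case: sliceC => sub _ _ /sub[]. Qed.

Let Ahx i x : Ck i x -> Ah i *m x = bh i.
Proof. by move=> [[_ x1] Ax]; apply/norm_mulmx. Qed.

Let iterateS k : p k.+1 = if cyc hn k \in I_GIS
  then mult_step (Ah (cyc hn k)) (bh (cyc hn k)) (p k)
  else KLproj (Ck (cyc hn k)) (p k).
Proof. by []. Qed.

(** Both claims go through one induction: a dominated point of [C] is what makes the next projection
    exist, and each kind of step preserves domination. *)
Lemma iterate_invariant k :
  nonneg (p k) /\ forall x, C x -> dominated x (p k).
Proof.
elim: k => [|k [p0 Cp]]; first by split=> [j|x _ j _]; rewrite ?ltW /p //=.
rewrite iterateS; set i := cyc hn k; case: ifP => _; split.
- exact: mult_step_ge0.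
- move=> x Cx; apply: dominated_mult_step (Cp x Cx) => //.
  + exact: normalized_norm.
  + exact: Cnonneg.
  + by apply: Ahx; exact: Cx.
- have [x Cx] := hC.
  have [[Dr _ _] _] := KLprojP (constraint_set_slice _ _) p0 (Cx i I) (Cp x Cx).
  by case: Dr => -[].
- move=> x Cx.
  have sl := constraint_set_slice (A i) (b i).
  have [rmin _] := KLprojP sl p0 (Cx i I) (Cp x Cx).
  by have [] := Kl_pythagoras sl rmin (Cx i I) (Cp x Cx).
Qed.

Let p0 k : nonneg (p k). Proof. by case: (iterate_invariant k). Qed.
Let Cp k x : C x -> dominated x (p k).
Proof. by case: (iterate_invariant k) => _; apply. Qed.

Let normAb i : normalized (Ah i) (bh i). Proof. exact: normalized_norm. Qed.

Lemma iterate_rhs0 k i : (Ah (cyc hn k) *m p k) i 0 = 0 -> bh (cyc hn k) i 0 = 0.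
Proof.
have [x Cx] := hC.
apply: mulmx_eq0_rhs (Cp k Cx) _ => //; first exact: Cnonneg.
by apply: Ahx; exact: Cx.
Qed.

Lemma iterate_projP k : cyc hn k \notin I_GIS ->
  Kl_minimizer (Ck (cyc hn k)) (p k) (p k.+1) /\
  KLargmin (Ck (cyc hn k)) (p k) = [set p k.+1].
Proof.
move=> /negbTE ki; have [x Cx] := hC; rewrite iterateS ki.
have sl := constraint_set_slice (A (cyc hn k)) (b (cyc hn k)).
exact: (KLprojP sl (p0 k) (Cx _ I) (Cp k Cx)).
Qed.

(** Free of [x], so that the telescoped identities of two points of [C] can be subtracted. *)
Let decrease k := if cyc hn k \in I_GIS
  then Kl (bh (cyc hn k)) (Ah (cyc hn k) *m p k) + (1 - \sum_j p k.+1 j 0)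
  else Kl (p k.+1) (p k).

Let Kl_iterateS k x : C x -> Kl x (p k) = Kl x (p k.+1) + decrease k.
Proof.
move=> Cx; rewrite /decrease; case: ifPn => ki.
  rewrite iterateS ki addrA; apply: Kl_mult_step => //.
  - exact: Cnonneg.
  - by apply: Ahx; exact: Cx.
  - exact: Cp.
have [rmin _] := iterate_projP ki.
have sl := constraint_set_slice (A (cyc hn k)) (b (cyc hn k)).
by have [] := Kl_pythagoras sl rmin (Cx _ I) (Cp k Cx).
Qed.

Let sum_GIS k : cyc hn k \in I_GIS -> \sum_j p k.+1 j 0 <= 1.
Proof.
move=> ki; rewrite iterateS ki; apply: sum_mult_step_le1 => //.
exact: iterate_rhs0.
Qed.

Let dominated_GIS k : dominated (bh (cyc hn k)) (Ah (cyc hn k) *m p k).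
Proof.
move=> i; rewrite lt_neqAle eq_sym => /andP[bi _].
rewrite lt_neqAle eq_sym (mulmx_ge0 (normAb _)) // andbT.
by apply: contraNneq bi => /iterate_rhs0 ->.
Qed.

Let bh_ge0 i : nonneg (bh i). Proof. by case: (normAb i). Qed.

Let Kl_GIS_le k : cyc hn k \in I_GIS ->
  Kl (bh (cyc hn k)) (Ah (cyc hn k) *m p k) <= decrease k.
Proof. by move=> ki; rewrite /decrease ki lerDl subr_ge0 sum_GIS. Qed.

Let Kl_GIS_ge0 k : 0 <= Kl (bh (cyc hn k)) (Ah (cyc hn k) *m p k).
Proof. by apply: Kl_ge0 => //; exact: (mulmx_ge0 (normAb _)). Qed.

Let decrease_ge0 k : 0 <= decrease k.
Proof.
have [ki|ki] := boolP (cyc hn k \in I_GIS).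
  exact: le_trans (Kl_GIS_ge0 k) (Kl_GIS_le ki).
rewrite /decrease (negbTE ki); have [[_ pp _] _] := iterate_projP ki.
exact: Kl_ge0.
Qed.

(** The 1 bounds the mass after any step, the sum bounds that of the starting point. *)
Let B := 1 + \sum_j q j 0.

Let B_ge1 : 1 <= B.
Proof. by rewrite /B lerDl sumr_ge0 // => j _; rewrite ltW. Qed.

Let sum_le k : \sum_j p k j 0 <= B.
Proof.
case: k => [|k]; first by rewrite /B lerDr.
apply: le_trans B_ge1; have [/sum_GIS //|ki] := boolP (cyc hn k \in I_GIS).
by have [[[[_ ->] _] _ _] _] := iterate_projP ki.
Qed.

Let p_le k j : p k j 0 <= B.
Proof. by apply: le_trans (sum_le k); exact: entry_le_sum. Qed.

Let Kl_iterate k x : C x -> Kl x q = Kl x (p k) + series decrease k.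
Proof.
move=> Cx; elim: k => [|k IH]; first by rewrite /series /= big_geq // addr0.
rewrite IH (Kl_iterateS k Cx) /series /= big_nat_recr //=; ring.
Qed.

Let decrease_cvg0 : decrease k @[k --> \oo] --> (0 : R).
Proof.
apply: cvg_series_cvg_0; apply: nondecreasing_is_cvgn.
  by apply/nondecreasing_seqP => k; rewrite /series /= big_nat_recr //= lerDl.
have [x Cx] := hC; exists (Kl x q) => _ [k _ <-].
rewrite (Kl_iterate k Cx) lerDr.
by apply: Kl_ge0; [exact: Cnonneg|exact: p0|exact: Cp].
Qed.

Let cyc_shift l r : cyc hn (n * l + r) = cyc hn r.
Proof. by apply: val_inj; rewrite /= mulnC modnMDl. Qed.

(** * Cluster points along multiples of the period *)

Section Limit.
Variables (U : set_system nat) (l : 'cV[R]_M).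
Hypotheses (UF : ProperFilter U) (ooU : \oo `<=` U).
Hypothesis (pl : forall j, p (n * t)%N j 0 @[t --> U] --> l j 0).

Let decrease_shift r : decrease (n * t + r)%N @[t --> U] --> (0 : R).
Proof.
move=> N /decrease_cvg0[k _ kN]; apply: ooU; exists k => // t /= kt.
by apply: kN => /=; rewrite (leq_trans kt) // (leq_trans (leq_pmull t hn)) // leq_addr.
Qed.

(** For a projection, vanishing decrease brings consecutive iterates together, and the new one lies
    in a closed set. For a multiplicative step it forces A p to converge to b, and [mult_step_cvg]
    carries the limit over. *)
Let limit_step r : (forall j, p (n * t + r)%N j 0 @[t --> U] --> l j 0) ->
  Ck (cyc hn r) l /\
  forall j, p (n * t + r.+1)%N j 0 @[t --> U] --> l j 0.
Proof.
move=> plr; have dr := decrease_shift r.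
pose e t := (n * t + r)%N.
have eS t : (n * t + r.+1)%N = (e t).+1 by rewrite addnS.
have ce t : cyc hn (e t) = cyc hn r by exact: cyc_shift.
have [ri|ri] := boolP (cyc hn r \in I_GIS); last first.
  have ei t : cyc hn (e t) \notin I_GIS by rewrite ce.
  have plS j : p (n * t + r.+1)%N j 0 @[t --> U] --> l j 0.
    have d0 : p (e t) j 0 - p (e t).+1 j 0 @[t --> U] --> (0 : R).
      (* The factor 2 (x + y) of [sqr_sub_le_kl] with both entries at most [B]. *)
      apply: (@cvg_sqr_le _ _ _ _ _ (decrease \o e) _ (4 * B)) => // [|t].
        by rewrite mulr_gt0 //; have := B_ge1; lra.
      have [[_ pp _] _] := iterate_projP (ei t).
      rewrite sub0r opprB.
      apply: (le_trans (sqr_sub_le_kl (p0 _ _) (p0 _ _) (pp j))).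
      rewrite /= /decrease (negbTE (ei t)).
      have := kl_le_Kl j (p0 (e t).+1) (p0 (e t)) pp.
      have := kl_ge0 (p0 (e t).+1 j) (p0 (e t) j) (pp j).
      have := p_le (e t) j; have := p_le (e t).+1 j.
      move=> pB pB' k0 kK; apply: ler_pM => //.
        by rewrite mulr_ge0 // addr_ge0 ?p0.
      lra.
    have -> : (fun t => p (n * t + r.+1)%N j 0) =
        (fun t => p (e t) j 0 - (p (e t) j 0 - p (e t).+1 j 0)).
      by apply/funext => t; rewrite eS; ring.
    by rewrite -[l j 0]subr0; apply: cvgB => //; exact: plr.
  split=> //; have [_ _ closed] := constraint_set_slice (A (cyc hn r)) (b (cyc hn r)).
  apply: (closed U (fun t => p (n * t + r.+1)%N)) => // t.
  have [[Cpt _ _] _] := iterate_projP (ei t).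
  by rewrite eS -(ce t).
have ei t : cyc hn (e t) \in I_GIS by rewrite ce.
have nA := normAb (cyc hn r).
have bh1 i : bh (cyc hn r) i 0 <= 1.
  by case: nA => _ _ b0 <-; exact: entry_le_sum.
have Apb i : (Ah (cyc hn r) *m p (e t)) i 0 @[t --> U] --> bh (cyc hn r) i 0.
  apply: (@cvg_sqr_le _ _ _ _ _ (decrease \o e) _ (2 * (1 + B))) => // [|t].
    by rewrite mulr_gt0 //; have := B_ge1; lra.
  have bA : dominated (bh (cyc hn r)) (Ah (cyc hn r) *m p (e t)).
    by rewrite -(ce t); exact: dominated_GIS.
  have A0 : nonneg (Ah (cyc hn r) *m p (e t)) by exact: (mulmx_ge0 nA).
  have b0 := @bh_ge0 (cyc hn r).
  apply: le_trans (sqr_sub_le_kl (b0 i) (A0 i) (bA i)) _.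
  have Kd : Kl (bh (cyc hn r)) (Ah (cyc hn r) *m p (e t)) <= decrease (e t).
    by rewrite -(ce t); exact: Kl_GIS_le.
  have AB : (Ah (cyc hn r) *m p (e t)) i 0 <= B.
    apply: le_trans (sum_le (e t)); rewrite -(sum_mulmx nA).
    exact: entry_le_sum.
  apply: ler_pM.
  - by rewrite mulr_ge0 // addr_ge0.
  - exact: kl_ge0 (b0 i) (A0 i) (bA i).
  - by rewrite ler_wpM2l // lerD.
  - exact: le_trans (kl_le_Kl i b0 A0 bA) Kd.
have stepE t : p (n * t + r.+1)%N =
    mult_step (Ah (cyc hn r)) (bh (cyc hn r)) (p (e t)).
  by rewrite eS iterateS ei ce.
have l0 j : 0 <= l j 0.
  by apply: (cvgr_le_le (cvg_cst 0) (plr j)) => t; exact: p0.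
split.
  have Al : Ah (cyc hn r) *m l = bh (cyc hn r).
    apply/colP => i; apply: cvgr_unique (Apb i); exact: cvg_mulmx_col.
  (* Multiplicative iterates need not have mass 1; the limit does, since the unit column sums give
     it the mass of [b]. *)
  have l1 : \sum_j l j 0 = 1.
    by rewrite -(sum_mulmx nA) Al; case: nA.
  by split; [split|apply/norm_mulmx].
move=> j; under eq_fun do rewrite stepE.
apply: mult_step_cvg => //.
under eq_fun do rewrite -stepE.
(* The mass defect is one of the two nonnegative summands of [decrease]. *)
apply: (@squeeze_cvgr _ _ _ _ (fun t => 1 - decrease (e t)) (fun=> 1)).
- apply: nearW => t; rewrite eS sum_GIS // andbT /decrease ei.
  by have := Kl_GIS_ge0 (e t); lra.
- by rewrite -[X in _ --> X]subr0; apply: cvgB; [exact: cvg_cst|exact: dr].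
- exact: cvg_cst.
Qed.

(** Induction on the offset [r] carries the limit through a full period, and offset [i] meets the
    [i]-th constraint set. *)
Lemma iterate_ultralimit : C l.
Proof.
have plr r : forall j, p (n * t + r)%N j 0 @[t --> U] --> l j 0.
  elim: r => [|r IH]; last by have [_] := limit_step IH.
  by move=> j; under eq_fun do rewrite addn0; exact: pl.
move=> i _; have [+ _] := limit_step (plr i).
suff -> : cyc hn i = i by [].
by apply: val_inj; rewrite /= modn_small.
Qed.

Let Kl_limit_cvg0 : Kl l (p k) @[k --> \oo] --> (0 : R).
Proof.
have Cl := iterate_ultralimit; have l0 := Cnonneg Cl.
have UKl : Kl l (p (n * t)%N) @[t --> U] --> (0 : R).
  have -> : (0 : R) = \sum_(j < M) 0 by rewrite big1.
  by apply: cvgr_sum => j; apply: kl_cvg0 => // t; [exact: p0|exact: Cp].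
have Kl0 k : 0 <= Kl l (p k) by apply: Kl_ge0 => //; exact: Cp.
have mono k k' : (k <= k')%N -> Kl l (p k') <= Kl l (p k).
  elim: k' => [|k' IH]; first by rewrite leqn0 => /eqP ->.
  rewrite leq_eqVlt => /predU1P[-> //|]; rewrite ltnS => /IH.
  by apply: le_trans; rewrite (Kl_iterateS k' Cl) lerDl.
apply/cvgr0Pnorm_lt => e e0.
have : \forall t \near U, `|Kl l (p (n * t)%N)| < e.
  by move/cvgr0Pnorm_lt: UKl; apply.
(* A single index with small divergence is enough, by monotonicity. *)
move=> /filter_ex[t]; rewrite ger0_norm // => lte.
exists (n * t)%N => // k /= /mono kt.
by rewrite ger0_norm //; exact: le_lt_trans kt lte.
Qed.

Lemma iterate_cvg : p k @[k --> \oo] --> l.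
Proof.
have Cl := iterate_ultralimit; have l0 := Cnonneg Cl.
apply: cvg_col => j.
apply: (@cvg_sqr_le _ _ _ _ _ (fun k => Kl l (p k)) _ (2 * (1 + B))) => // [|k].
  by rewrite mulr_gt0 //; have := B_ge1; lra.
have lp := Cp k Cl.
apply: le_trans (sqr_sub_le_kl (l0 j) (p0 k j) (lp j)) _.
apply: ler_pM.
- by rewrite mulr_ge0 // addr_ge0 ?p0.
- exact: kl_ge0 (l0 j) (p0 k j) (lp j).
- rewrite ler_wpM2l // lerD // ?p_le //.
  case: sliceC => sub _ _; have [_ <-] := sub _ Cl.
  exact: entry_le_sum.
- exact: kl_le_Kl j l0 (p0 k) lp.
Qed.

(** Subtracting the telescoped identities at [l] and [x] gives Kl l q - Kl l p_k = Kl x q - Kl x p_k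
    <= Kl x q; then let k grow. *)
Lemma iterate_limit_minimizer : Kl_minimizer C q l.
Proof.
have Cl := iterate_ultralimit.
split=> // x Cx _.
have h k : Kl l q <= Kl x q + Kl l (p k).
  rewrite (Kl_iterate k Cx) (Kl_iterate k Cl) addrC lerD2r lerDr.
  by apply: Kl_ge0; [exact: Cnonneg|exact: p0|exact: Cp].
have lim : Kl x q + Kl l (p k) @[k --> \oo] --> Kl x q + 0.
  by apply: cvgD; [exact: cvg_cst|exact: Kl_limit_cvg0].
by rewrite addr0 in lim; exact: (cvgr_le_le (cvg_cst _) lim h).
Qed.

End Limit.

Lemma iterate_cvg_KLproj :
  KLargmin C q = [set KLproj C q] /\ p k @[k --> \oo] --> KLproj C q.
Proof.
have q0 : nonneg q by move=> j; exact: ltW.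
have [x Cx] := hC; have xq : dominated x q by move=> j _.
have [_ argminE] := KLprojP sliceC q0 Cx xq.
split=> //; have [U [UU ooU]] := ultraFilterLemma (@eventually_filter).
have UF : ProperFilter U by exact: ultra_proper.
have pB t j : 0 <= p (n * t)%N j 0 <= B by rewrite p0 p_le.
have [l pl] := ultra_bounded_cV_cvg UU pB.
suff -> : KLproj C q = l by exact: iterate_cvg UF ooU pl.
have := KLargmin_unique sliceC q0 (iterate_limit_minimizer UF ooU pl).
by rewrite argminE => /seteqP[/(_ _ erefl)].
Qed.

End Iteration.

(* The first two conjuncts say that every quotient and every projection used
   along the iteration is well defined. *)
Theorem theorem3p1 (R : realType) (M n : nat) (hM : (0 < M)%N) (hn : (0 < n)%N)
    (q : 'cV[R]_M) (hq : forall j, 0 < q j 0)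
    (m : 'I_n -> nat)
    (A : forall k, 'M[R]_(m k, M)) (b : forall k, 'cV[R]_(m k))
    (hC : (\bigcap_k constraint_set (A k) (b k)) !=set0)
    (I_GIS : {set 'I_n}) :
  let C := \bigcap_k constraint_set (A k) (b k) in
  let p := iterate hn A b I_GIS q in
  [/\ forall k, cyc hn k \in I_GIS ->
        let Ah := norm_A (A (cyc hn k)) (b (cyc hn k)) in
        let bh := norm_b (A (cyc hn k)) (b (cyc hn k)) in
        forall i, (Ah *m p k) i 0 = 0 -> bh i 0 = 0,
      forall k, cyc hn k \notin I_GIS ->
        KLargmin (constraint_set (A (cyc hn k)) (b (cyc hn k))) (p k)
          = [set p k.+1],
      KLargmin C q = [set KLproj C q] &
      p k @[k --> \oo] --> KLproj C q].

Proof.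
move=> C p; have [argminE lim] := iterate_cvg_KLproj hn hq I_GIS hC.
split=> // k ki; first by move=> i; exact: iterate_rhs0.
by have [_ ->] := iterate_projP hq hC ki.
Qed.
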